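(* Let $K$ be a field, let $\sigma$ be a non-identity automorphism of $K$, let $k=\{\alpha\in K:\sigma(\alpha)=\alpha\}$ be the fixed field of $\sigma$, and let $k_0$ be the prime field of $K$. Assume that $k$ has infinite transcendence degree over $k_0$. Then the multiplicative group $K(t;\sigma)^*$ contains a free non-cyclic subgroup.
   Context: $K(t;\sigma)$ denotes the quotient division ring of the skew polynomial ring $K[t;\sigma]$, which is the left $K$-module $K[t]$ with multiplication determined by $ta=\sigma(a)t$ for $a\in K$. For a division ring $D$, $D^*=D\setminus\{0\}$ is its multiplicative group. *)

(* Defs.v *)
From HB Require Import structures.
From mathcomp Require Import all_boot all_order all_algebra.
From mathcomp Require Import boolp.
From mathcomp Require Import mpoly.

Set Implicit Arguments.
Unset Strict Implicit.
Unset Printing Implicit Defensive.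

Import GRing.Theory.
Local Open Scope ring_scope.

HB.mixin Record UnitRing_isDivisionRing D of GRing.UnitRing D := {
  neq0_unit : forall x : D, x != 0 -> x \is a GRing.unit
}.

#[short(type="divisionRingType")]
HB.structure Definition DivisionRing :=
  { D of UnitRing_isDivisionRing D & GRing.UnitRing D }.

Arguments neq0_unit {s} [x].

Definition nonzero (D : divisionRingType) := {x : D | x != 0}.

Section NonzeroGroup.
Variable D : divisionRingType.

HB.instance Definition _ := Choice.on (nonzero D).

Fact nz_mul_subproof (x y : nonzero D) : val x * val y != 0.
Proof.
apply/eqP => xy0; have /eqP := valP y; apply.
by rewrite -(mulKr (neq0_unit (valP x)) (val y)) xy0 mulr0.
Qed.

Fact nz_inv_subproof (x : nonzero D) : (val x)^-1 != 0.
Proof.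
apply/eqP => x0; have := oner_neq0 D.
by rewrite -(divrr (neq0_unit (valP x))) x0 mulr0 eqxx.
Qed.

Definition nz_one : nonzero D := exist _ 1 (oner_neq0 D).
Definition nz_mul (x y : nonzero D) : nonzero D :=
  exist _ (val x * val y) (nz_mul_subproof x y).
Definition nz_inv (x : nonzero D) : nonzero D :=
  exist _ (val x)^-1 (nz_inv_subproof x).

Fact nz_mulA : associative nz_mul.
Proof. by move=> x y z; apply: val_inj; rewrite /= mulrA. Qed.
Fact nz_mul1 : left_id nz_one nz_mul.
Proof. by move=> x; apply: val_inj; rewrite /= mul1r. Qed.
Fact nz_mulr1 : right_id nz_one nz_mul.
Proof. by move=> x; apply: val_inj; rewrite /= mulr1. Qed.
Fact nz_mulV : left_inverse nz_one nz_inv nz_mul.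
Proof. by move=> x; apply: val_inj; rewrite /= mulVr // neq0_unit // (valP x). Qed.
Fact nz_mulrV : right_inverse nz_one nz_inv nz_mul.
Proof. by move=> x; apply: val_inj; rewrite /= divrr // neq0_unit // (valP x). Qed.

HB.instance Definition _ := isGroup.Build (nonzero D)
  nz_mulA nz_mul1 nz_mulr1 nz_mulV nz_mulrV.

End NonzeroGroup.

Section FreeSubgroup.
Variable G : groupType.
Implicit Types (H X : {pred G}) (w : seq (G * bool)).

(* The letter (x, false) stands for x, and (x, true) for x^-1. *)
Definition letter_val (l : G * bool) : G := (if l.2 then l.1^-1 else l.1)%g.

Definition word_val w : G := (\prod_(l <- w) letter_val l)%g.

Definition word_on X w := all [pred l | l.1 \in X] w.

Definition reduced w :=
  sorted [rel l l' | ~~ ((l.1 == l'.1) && (l.2 != l'.2))] w.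

Definition free_basis H X := {subset X <= H} /\
  forall h, h \in H -> exists! w, [/\ word_on X w, reduced w & word_val w = h].

Definition is_free H := exists X, free_basis H X.

Definition is_cyclic H :=
  exists g : G, forall h, h \in H <-> exists n, (h = g ^+ n \/ h = g ^- n)%g.

End FreeSubgroup.

(* Same left K-module as {poly K}, but not the same product: use this alias,
   not {poly K}, to access the ring structure. *)
Definition skew_poly (K : fieldType) (sigma : {rmorphism K -> K}) := {poly K}.

Section SkewPolynomials.
Variables (K : fieldType) (sigma : {rmorphism K -> K}).
Local Notation R := (skew_poly sigma).

HB.instance Definition _ := GRing.Lmodule.copy R {poly K}.

(* The i-th coefficient comes from
   (a t^j) (b t^(i - j)) = a sigma^j(b) t^i. *)
Definition skew_mul (p q : {poly K}) : {poly K} :=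
  \poly_(i < (size p + size q).-1)
     (\sum_(j < i.+1) p`_j * iter j sigma q`_(i - j)).

Fact siter0 n : iter n sigma 0 = 0.
Proof. by elim: n => //= n ->; rewrite rmorph0. Qed.
Fact siter1 n : iter n sigma 1 = 1.
Proof. by elim: n => //= n ->; rewrite rmorph1. Qed.
Fact siterD n : {morph iter n sigma : x y / x + y}.
Proof. by move=> x y; elim: n => //= n ->; rewrite rmorphD. Qed.
Fact siterM n : {morph iter n sigma : x y / x * y}.
Proof. by move=> x y; elim: n => //= n ->; rewrite rmorphM. Qed.
Fact siter_sum n I (r : seq I) (F : I -> K) :
  iter n sigma (\sum_(i <- r) F i) = \sum_(i <- r) iter n sigma (F i).
Proof. exact: (big_morph _ (@siterD n) (siter0 n)). Qed.

Lemma coef_skew_mul p q i :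
  (skew_mul p q)`_i = \sum_(j < i.+1) p`_j * iter j sigma q`_(i - j).
Proof.
rewrite coef_poly ltn_predRL; case: leqP => // le_pq_i1.
rewrite big1 // => j _; have [lq_p_j|lt_j_p] := leqP (size p) j.
  by rewrite nth_default ?mul0r.
rewrite [q`__]nth_default ?siter0 ?mulr0 // leq_subRL -ltnS //.
by rewrite (leq_trans _ le_pq_i1) // ltn_add2r.
Qed.

Fact coef_skew_mul_rev p q i :
  (skew_mul p q)`_i = \sum_(j < i.+1) p`_(i - j) * iter (i - j) sigma q`_j.
Proof.
rewrite coef_skew_mul (reindex_inj rev_ord_inj) /=.
by apply: eq_bigr => j _; rewrite subSS (sub_ordK j).
Qed.

Fact skew_mulA : associative skew_mul.
Proof.
move=> p q r; apply/polyP=> i; rewrite coef_skew_mul coef_skew_mul_rev.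
pose coef3 j k :=
  p`_j * (iter j sigma q`_(i - j - k) * iter (i - k) sigma r`_k).
transitivity (\sum_(j < i.+1) \sum_(k < i.+1 | (k <= i - j)%N) coef3 j k).
  apply: eq_bigr => /= j _; rewrite coef_skew_mul_rev siter_sum big_distrr /=.
  rewrite (big_ord_narrow_leq (leq_subr _ _)) /=; apply: eq_bigr => k _.
  have lejk : (j <= i - k)%N.
    have lekj : (k <= i - j)%N by rewrite -ltnS ltn_ord.
    rewrite leq_subRL ?(leq_trans lekj) ?leq_subr // addnC.
    by rewrite -leq_subRL // -ltnS.
  by rewrite siterM /coef3 -iterD -subnDA [(j + k)%N]addnC subnDA subnKC.
rewrite (exchange_big_dep predT) //=; apply: eq_bigr => k _.
transitivity (\sum_(j < i.+1 | (j <= i - k)%N) coef3 j k).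
  apply: eq_bigl => j; rewrite -ltnS -(ltnS j) -!subSn ?leq_ord //.
  by rewrite -subn_gt0 -(subn_gt0 j) -!subnDA addnC.
rewrite (big_ord_narrow_leq (leq_subr _ _)) coef_skew_mul big_distrl /=.
by apply: eq_bigr => j _; rewrite /coef3 subnAC mulrA.
Qed.

Fact skew_mul1p : left_id 1%:P skew_mul.
Proof.
move=> p; apply/polyP => i; rewrite coef_skew_mul big_ord_recl subn0 coefC eqxx.
by rewrite big1 => [|j _]; rewrite ?coefC /= ?mul1r ?addr0 ?mul0r.
Qed.

Fact skew_mulp1 : right_id 1%:P skew_mul.
Proof.
move=> p; apply/polyP => i; rewrite coef_skew_mul_rev big_ord_recl subn0 coefC.
rewrite eqxx siter1 mulr1 big1 => [|j _]; rewrite ?addr0 //.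
by rewrite coefC /= siter0 mulr0.
Qed.

Fact skew_mulDl : left_distributive skew_mul +%R.
Proof.
move=> p q r; apply/polyP=> i; rewrite coefD !coef_skew_mul -big_split.
by apply: eq_bigr => j _; rewrite coefD mulrDl.
Qed.

Fact skew_mulDr : right_distributive skew_mul +%R.
Proof.
move=> p q r; apply/polyP=> i; rewrite coefD !coef_skew_mul -big_split.
by apply: eq_bigr => j _; rewrite coefD siterD mulrDr.
Qed.

Fact skew_1neq0 : (1%:P : R) != 0.
Proof. exact: poly1_neq0. Qed.

HB.instance Definition _ := GRing.Zmodule_isNzRing.Build R
  skew_mulA skew_mul1p skew_mulp1 skew_mulDl skew_mulDr skew_1neq0.

Definition skewC (a : K) : R := a%:P.
Definition skewX : R := 'X.

Lemma skewX_C a : skewX * skewC a = skewC (sigma a) * skewX.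
Proof.
apply/polyP => i; rewrite /skewX /skewC !coef_skew_mul.
case: i => [|i]; first by rewrite !big_ord1 !coefX !(mul0r, mulr0).
rewrite !big_ord_recl /= !big1 => [|j _|j _].
- rewrite !addr0 /bump /= !subn0 subn1 /= !coefX !coefC /= mul0r add0r mul1r.
  by rewrite mul0r addr0; case: i => [|i]; rewrite /= ?mulr1 // rmorph0 mulr0.
- by rewrite coefC mul0r.
- by rewrite coefX mul0r.
Qed.

Lemma skewC_mul a (p : R) : skewC a * p = a *: p.
Proof.
apply/polyP => i; rewrite /skewC coef_skew_mul coefZ big_ord_recl coefC eqxx subn0.
by rewrite big1 ?addr0 // => j _; rewrite coefC mul0r.
Qed.

Lemma skew_polyE (p : R) : p = \sum_(i < size p) skewC p`_i * skewX ^+ i.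
Proof.
have Xn i : skewX ^+ i = 'X^i :> {poly K}.
  elim: i => [|i IHi]; rewrite ?expr0 // [LHS]exprS; apply/polyP => n.
  rewrite coef_skew_mul coefXn; case: n => [|n].
    by rewrite big_ord1 coefX mul0r.
  rewrite !big_ord_recl /= coefX mul0r add0r coefX mul1r subn1 IHi coefXn.
  rewrite big1 ?addr0 => [|j _]; last by rewrite coefX mul0r.
  by rewrite /= eqSS; case: (n == i); rewrite ?rmorph0 ?rmorph1.
rewrite -[LHS](coefK (p : {poly K})) poly_def; apply: eq_bigr => i _.
by rewrite skewC_mul Xn.
Qed.

End SkewPolynomials.

(* [f] exhibits [D] as the division ring of left fractions of [R]. For a left
   and right Ore domain, such as K[t; sigma] with sigma bijective, these are
   also the right fractions. *)
Definition quotient_division_ring (R : nzRingType) (D : divisionRingType)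
    (f : {rmorphism R -> D}) :=
  injective f /\ forall x : D, exists p q : R, q != 0 /\ x = (f q)^-1 * f p.

Definition fixed_field (K : fieldType) (sigma : {rmorphism K -> K}) : {pred K} :=
  [pred a | sigma a == a].

Definition prime_field (K : fieldType) : {pred K} :=
  [pred a | `[< forall F : {pred K}, GRing.divring_closed F -> a \in F >]].
Arguments prime_field : clear implicits.

Section TranscendenceDegree.
Variable K : fieldType.
Implicit Types F E S : {pred K}.

Definition alg_independent F S :=
  forall n (x : 'I_n -> K), injective x -> (forall i, x i \in S) ->
  forall p : {mpoly K[n]}, p \is a mpolyOver n F -> p.@[x] = 0 -> p = 0.

Definition transcendence_basis F E S :=
  [/\ {subset S <= E}, alg_independent F S &
      forall S', {subset S' <= E} -> alg_independent F S' ->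
        {subset S <= S'} -> {subset S' <= S}].

(* All transcendence bases of E over F have the same cardinality. *)
Definition infinite_trdeg F E := exists S,
  transcendence_basis F E S /\ ~ exists s : seq K, {subset S <= s}.

End TranscendenceDegree.

(* Main.v *)
From HB Require Import structures.
Require Import Defs.
From mathcomp Require Import all_boot all_order all_algebra.
From mathcomp Require Import boolp mpoly ring.

(**
Write P_c = c - t. For letters l = (b, b') with opposite l' = (b, ~~ b'), and
coefficients c_l in a sigma-stable subfield F of K, put g_l = P_{c_l'} P_{c_l}^-1,
so that g_l' = g_l^-1. A reduced word l_1 ... l_n has tails
X_i = P_{c_{l_i}}^-1 g_{l_{i+1}} ... g_{l_n}. Multiplying a left F-linear relation
between the tails modulo K[t; sigma] by P_{c_{l_1}} shortens it, and shows by
induction that there is none, provided that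
  c_j psi - c_l sigma(psi) = c_l - c_l'   has no solution psi in F when j <> l'.
Then no nonempty reduced word equals 1, and two of the g_l freely generate a group.

To choose the coefficients, let sigma(a) <> a and take x_l in the fixed field k,
each transcendental over the field M_l generated by the sigma-orbit of a and the
other three. With c_l = (x_l - sigma(a)) / (x_l - a), the condition becomes the
insolubility of sigma(h) - h = A (x - sigma(a)) / (x - a) - B with x = x_l' and
A <> 0, B in M_l'. If the orbit of a is finite, sum over it: the right-hand side
keeps a pole at x = a. If it is infinite, the poles of h on the orbit would have
to propagate forever in one direction.

The x_l exist because either the orbit has finite transcendence degree, or it is
independent; in the latter case an element of k algebraic over the orbit depends
on arbitrarily translated finite windows of it, contradicting independence.
*)

Set Implicit Arguments.
Unset Strict Implicit.
Unset Printing Implicit Defensive.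

Import GRing.Theory.
Local Open Scope ring_scope.

(** * Algebraic closure of a subset of a field *)

(** A subfield becomes a type of its own so that the theory of [integralOver] applies; it gives
    closure of algebraic elements under subtraction and division. *)
Record subfieldType (K : fieldType) (S : divringClosed K) :=
  Subfield {subfield_val :> K; _ : subfield_val \in S}.

Section SubfieldType.
Variables (K : fieldType) (S : divringClosed K).
HB.instance Definition _ := [isSub for @subfield_val K S].
HB.instance Definition _ := [Choice of subfieldType S by <:].
HB.instance Definition _ :=
  [SubChoice_isSubComUnitRing of subfieldType S by <:].
HB.instance Definition _ :=
  [SubComUnitRing_isSubIntegralDomain of subfieldType S by <:].
HB.instance Definition _ :=
  [SubIntegralDomain_isSubField of subfieldType S by <:].
End SubfieldType.

Section AlgebraicClosure.
Variable K : fieldType.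
Implicit Types (F A : {pred K}) (U V : K -> Prop) (y z : K) (p : {poly K}).

Definition algebraic F z := exists p, [/\ p \is a polyOver F, p != 0 & root p z].

Lemma algebraic_over (S : divringClosed K) z :
  algebraic S z <-> integralOver (val : subfieldType S -> K) z.
Proof.
split=> [[p [/polyOverP Sp p0 pz]]|/integral_algebraic[p p0 pz]].
  apply/integral_algebraic.
  have Ep : p = map_poly (val : subfieldType S -> K)
      (\poly_(i < size p) Subfield (Sp i)).
    apply/polyP=> i; rewrite coef_map /= coef_poly; case: ltnP => //= le_pi.
    by rewrite nth_default.
  by exists (\poly_(i < size p) Subfield (Sp i)); rewrite -?(map_poly_eq0 val) -Ep.
exists (map_poly val p); split=> //; last by rewrite map_poly_eq0.
by apply/polyOverP=> i; rewrite coef_map; case: (p`_i).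
Qed.

Lemma algebraicS F A : {subset F <= A} -> forall z, algebraic F z -> algebraic A z.
Proof.
by move=> sFA z [p [Fp p0 pz]]; exists p; split=> //; apply: polyOverS Fp.
Qed.

(** The subfield generated by [U], taken as an intersection: a property of its elements is proved by
    exhibiting one subfield, through [gen_field_min]. *)
Definition gen_field U : {pred K} :=
  [pred z | `[< forall F, GRing.divring_closed F -> (forall y, U y -> y \in F) ->
                z \in F >]].

Lemma sub_gen_field U y : U y -> y \in gen_field U.
Proof. by move=> Uy; apply/asboolP => F _; apply. Qed.

Lemma gen_field_min U F : GRing.divring_closed F -> (forall y, U y -> y \in F) ->
  {subset gen_field U <= F}.
Proof. by move=> dF sUF z /asboolP; apply. Qed.

Fact gen_field_divring U : GRing.divring_closed (gen_field U).
Proof.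
split=> [|x y /asboolP Ux /asboolP Uy|x y /asboolP Ux /asboolP Uy].
- by apply/asboolP=> F [].
- by apply/asboolP=> F dF sUF; have [_ + _] := dF; apply; [apply: Ux|apply: Uy].
- by apply/asboolP=> F dF sUF; have [_ _] := dF; apply; [apply: Ux|apply: Uy].
Qed.
HB.instance Definition _ U :=
  GRing.isDivringClosed.Build K (gen_field U) (gen_field_divring U).

(** The closure operator of algebraic dependence; [acl_algebraic] makes it idempotent and
    [acl_exchange] gives the exchange property. *)
Definition acl U : {pred K} := [pred z | `[< algebraic (gen_field U) z >]].

Fact acl_divring U : GRing.divring_closed (acl U).
Proof.
split=> [|x y /asboolP/algebraic_over ax /asboolP/algebraic_over ay
         |x y /asboolP/algebraic_over ax /asboolP/algebraic_over ay].
- exact/asboolP/algebraic_over/integral1.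
- exact/asboolP/algebraic_over/integral_sub.
- exact/asboolP/algebraic_over/integral_div.
Qed.
HB.instance Definition _ U :=
  GRing.isDivringClosed.Build K (acl U) (acl_divring U).

Lemma sub_gen_acl U : {subset gen_field U <= acl U}.
Proof.
move=> y Uy; apply/asboolP/algebraic_over.
exact: (@integral_id _ _ val (Subfield Uy)).
Qed.

Lemma sub_acl U y : U y -> y \in acl U.
Proof. by move/sub_gen_field/sub_gen_acl. Qed.

Lemma acl_algebraic U z : algebraic (acl U) z -> z \in acl U.
Proof.
case=> p [/polyOverP Ap p0 pz]; apply/asboolP/algebraic_over.
apply: integral_root p0 pz _ => _ /(nthP 0)[i _ <-].
by apply/algebraic_over; have /asboolP := Ap i.
Qed.

(** Asking only that the generators lie in [acl V] covers monotonicity and transitivity at once. *)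
Lemma aclS U V : (forall y, U y -> y \in acl V) -> {subset acl U <= acl V}.
Proof.
move=> sUV z /asboolP az; apply: acl_algebraic; apply: algebraicS az.
exact: gen_field_min (acl_divring V) sUV.
Qed.

Definition quotients A : {pred K} :=
  [pred z | `[< exists a b, [/\ a \in A, b \in A, b != 0 & z = a / b] >]].

Section Fractions.
Variable A : subringClosed K.

Fact quotients_divring : GRing.divring_closed (quotients A).
Proof.
split=> [|x y|x y].
- by apply/asboolP; exists 1, 1; rewrite rpred1 oner_neq0 divr1.
- move=> /asboolP[a [b [Aa Ab b0 ->]]] /asboolP[c [d [Ac Ad d0 ->]]].
  apply/asboolP; exists (a * d - c * b), (b * d).
  by split; rewrite ?mulf_neq0 ?rpredB ?rpredM //; field; rewrite b0 d0.
- move=> /asboolP[a [b [Aa Ab b0 ->]]] /asboolP[c [d [Ac Ad d0 ->]]].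
  have [->|c0] := eqVneq c 0; apply/asboolP.
    by exists 0, 1; rewrite rpred0 rpred1 oner_neq0 !(mul0r, invr0, mulr0).
  exists (a * d), (b * c).
  by split; rewrite ?mulf_neq0 ?rpredM // invf_div mulf_div.
Qed.
HB.instance Definition _ := GRing.isDivringClosed.Build K (quotients A) quotients_divring.

Lemma sub_quotients : {subset A <= quotients A}.
Proof.
by move=> a Aa; apply/asboolP; exists a, 1; rewrite rpred1 oner_neq0 divr1.
Qed.

Lemma common_denominator (s : seq K) : {subset s <= quotients A} ->
  exists b, [/\ b \in A, b != 0 & forall z, z \in s -> b * z \in A].
Proof.
elim: s => [|c s IHs] sA; first by exists 1; rewrite rpred1 oner_neq0.
have [z sz|b [Ab b0 bs]] := IHs; first by apply: sA; rewrite inE sz orbT.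
have /asboolP[u [v [Au Av v0 Ec]]] := sA c (mem_head _ _).
exists (b * v); split; rewrite ?mulf_neq0 ?rpredM // => z.
rewrite inE => /predU1P[->|sz].
  by rewrite Ec -mulrA [v * _]mulrC divfK // rpredM.
by rewrite mulrAC rpredM // bs.
Qed.

(** Multiplying by a common denominator of the coefficients keeps the roots. *)
Lemma algebraic_quotients z : algebraic (quotients A) z -> algebraic A z.
Proof.
case=> p [/polyOverP Ap p0 pz].
have [|b [Ab b0 bp]] := @common_denominator p.
  by move=> _ /(nthP 0)[i _ <-].
exists (b *: p); split; last by rewrite rootE hornerZ (eqP pz) mulr0.
  apply/polyOverP=> i; rewrite coefZ; have [le_pi|lt_ip] := leqP (size p) i.
    by rewrite nth_default // mulr0 rpred0.
  by apply: bp; rewrite mem_nth.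
by rewrite scaler_eq0 negb_or b0.
Qed.

End Fractions.

Definition poly_values F x : {pred K} :=
  [pred z | `[< exists2 p, p \is a polyOver F & z = p.[x] >]].

Fact poly_values_subring (F : divringClosed K) x :
  GRing.subring_closed (poly_values F x).
Proof.
split=> [|y z|y z].
- by apply/asboolP; exists 1; rewrite ?rpred1 ?hornerC.
- move=> /asboolP[p Fp ->] /asboolP[q Fq ->].
  by apply/asboolP; exists (p - q); rewrite ?rpredB ?hornerE.
- move=> /asboolP[p Fp ->] /asboolP[q Fq ->].
  by apply/asboolP; exists (p * q); rewrite ?rpredM ?hornerM.
Qed.
HB.instance Definition _ (F : divringClosed K) x :=
  GRing.isSubringClosed.Build K (poly_values F x) (poly_values_subring F x).

Lemma gen_field_poly_values (F : divringClosed K) U x :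
  (forall y, U y -> y \in F \/ y = x) ->
  {subset gen_field U <= quotients (poly_values F x)}.
Proof.
move=> sU; apply: gen_field_min => [|y /sU[Fy|->]]; first exact: quotients_divring.
  apply: sub_quotients; apply/asboolP.
  by exists y%:P; rewrite ?polyOverC ?hornerC.
by apply: sub_quotients; apply/asboolP; exists 'X; rewrite ?polyOverX ?hornerX.
Qed.

(** * Exchange property and Steinitz bound *)

Definition adjoin x U := fun y => y = x \/ U y.

(** Clearing denominators in an equation for [y] gives a relation [\sum_i P_i(x) y^i = 0] with every
    [P_i] over [gen_field U]. Read as a polynomial in [x], it is an equation for [x] over the field
    generated by [y] and [U]. *)
Lemma acl_exchange U x y :
  y \in acl (adjoin x U) -> y \notin acl U -> x \in acl (adjoin y U).
Proof.
move=> /asboolP ay Uy; set G := gen_field U.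
have {}ay : algebraic (quotients (poly_values G x)) y.
  apply: algebraicS ay; apply: gen_field_poly_values => z [->|Uz]; first by right.
  by left; apply: sub_gen_field.
have [p [/polyOverP Ap p0 py]] := algebraic_quotients ay.
have /choice[P PP] i : exists q, q \is a polyOver G /\ p`_i = q.[x].
  by have /asboolP[q Gq ->] := Ap i; exists q.
pose r := \sum_(i < size p) y ^+ i *: P i.
apply/asboolP; exists r; split.
- rewrite rpred_sum // => i _; apply: polyOverZ.
    by rewrite rpredX //; apply: sub_gen_field; left.
  apply: polyOverS (PP i).1; apply: gen_field_min => [|z Uz].
    exact: gen_field_divring.
  by apply: sub_gen_field; right.
- apply/eqP=> r0; case/eqP: p0; apply/polyP=> i; rewrite coef0 (PP i).2.
  have [le_pi|lt_ip] := leqP (size p) i.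
    by rewrite -(PP i).2 nth_default.
  suff -> : P i = 0 by rewrite horner0.
  (* If this coefficient were nonzero, the coefficients of degree [k] of all the [P j] would form a
     nonzero polynomial over [G] with root [y]. *)
  apply/polyP=> k; rewrite coef0; apply/eqP/negPn/negP => Pik.
  case/negP: Uy; apply/asboolP; exists (\poly_(j < size p) (P j)`_k); split.
  + by apply: polyOver_poly => j _; have /polyOverP := (PP j).1.
  + apply/eqP=> /polyP/(_ i); rewrite coef_poly lt_ip coef0; exact/eqP.
  + rewrite rootE horner_poly; have /polyP/(_ k) := r0; rewrite coef0 coef_sum.
    by move/eqP; apply: etrans; congr (_ == _); apply: eq_bigr => j _; rewrite coefZ mulrC.
- rewrite rootE horner_sum; apply/eqP; rewrite -[RHS](eqP py) horner_coef.
  by apply: eq_bigr => i _; rewrite hornerZ (PP i).2 mulrC.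
Qed.

Fixpoint acl_independent U (s : seq K) :=
  if s is y :: s' then y \notin acl U /\ acl_independent (adjoin y U) s' else True.

Definition adjoin_seq U (s : seq K) := fun y => U y \/ y \in s.

(** Replacement step: [z] heads the shortest suffix of [t] over which [y] is algebraic, so exchange
    applies to [z]; the other entries form [t']. *)
Lemma adjoin_first U (t : seq K) y : y \notin acl U -> y \in acl (adjoin_seq U t) ->
  exists z t', [/\ size t = (size t').+1, z \in acl (adjoin y (adjoin_seq U t')) &
    forall w, w \in t -> w = z \/ w \in t'].
Proof.
move=> Uy; elim: t => [|z t IHt] ay.
  by case/negP: Uy; apply: aclS ay => w [|//]; apply: sub_acl.
have [ay'|nay] := boolP (y \in acl (adjoin_seq U t)).
  have [w [t' [Est aw stt']]] := IHt ay'; exists w, (z :: t'); split.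
  - by rewrite /= Est.
  - apply: aclS aw => v [->|[Uv|t'v]]; apply: sub_acl; [by left|by right; left|].
    by right; right; rewrite inE t'v orbT.
  move=> v; rewrite inE => /predU1P[->|/stt'[->|t'v]].
  - by right; apply: mem_head.
  - by left.
  - by right; rewrite inE t'v orbT.
exists z, t; split=> // [|w]; last by rewrite inE => /predU1P[]; [left|right].
apply: acl_exchange nay; apply: aclS ay => w [Uw|]; first by apply: sub_acl; right; left.
rewrite inE => /predU1P[->|tw]; apply: sub_acl; first by left.
by right; right.
Qed.

(** Each entry of [s] in turn moves into the base [U] and displaces one entry of [t]. *)
Lemma steinitz U (s t : seq K) : acl_independent U s ->
  (forall y, y \in s -> y \in acl (adjoin_seq U t)) -> (size s <= size t)%N.
Proof.
elim: s U t => // y s IHs U t [Uy sind] sat.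
have [z [t' [-> az stt']]] := adjoin_first Uy (sat y (mem_head _ _)).
rewrite ltnS; apply: (IHs _ _ sind) => w sw.
have {sw} : w \in acl (adjoin_seq U t) by apply: sat; rewrite inE sw orbT.
have to_t' v : v \in acl (adjoin y (adjoin_seq U t')) ->
    v \in acl (adjoin_seq (adjoin y U) t').
  apply: aclS => u [->|[Uu|t'u]]; apply: sub_acl; [by left; left|by left; right|by right].
by apply: aclS => v [Uv|/stt'[->|t'v]]; [apply: sub_acl; left; right|apply: to_t'|apply: sub_acl; right].
Qed.

Lemma acl_exchange_notin U x y : x \notin acl U -> y \notin acl (adjoin x U) ->
  x \notin acl (adjoin y U).
Proof. by move=> Ux ayx; apply: contra ayx => axy; apply: acl_exchange Ux. Qed.

End AlgebraicClosure.

Section Morphism.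
Variables (K : fieldType) (sigma : {rmorphism K -> K}).
Implicit Types U V : K -> Prop.

Lemma preim_divring (S : divringClosed K) :
  GRing.divring_closed [pred z | sigma z \in S].
Proof.
split=> [|x y|x y]; rewrite !inE ?rmorph1 ?rpred1 // => Sx Sy.
  by rewrite rmorphB rpredB.
by rewrite fmorph_div rpred_div.
Qed.

Lemma rmorph_gen_field U (S : divringClosed K) :
    (forall y, U y -> sigma y \in S) ->
  forall z, z \in gen_field U -> sigma z \in S.
Proof. exact: (gen_field_min (preim_divring S)). Qed.

Lemma rmorph_acl U V : (forall y, U y -> sigma y \in acl V) ->
  forall z, z \in acl U -> sigma z \in acl V.
Proof.
move=> sUV z /asboolP[p [/polyOverP Up p0 pz]].
apply: acl_algebraic; exists (map_poly sigma p); split.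
- apply/polyOverP=> i; rewrite coef_map.
  exact: (@rmorph_gen_field U (acl V)).
- by rewrite map_poly_eq0.
- by rewrite rootE horner_map (eqP pz) rmorph0.
Qed.
End Morphism.

(** * Transcendence degree over the prime field *)

Section PrimeField.
Variable K : fieldType.
Implicit Types (U : K -> Prop) (z : K).

Fact prime_field_divring : GRing.divring_closed (prime_field K).
Proof.
split=> [|x y /asboolP kx /asboolP ky|x y /asboolP kx /asboolP ky];
  apply/asboolP=> F dF; have [F1 FB Fdiv] := dF => //.
- by apply: FB; [apply: kx|apply: ky].
- by apply: Fdiv; [apply: kx|apply: ky].
Qed.
HB.instance Definition _ :=
  GRing.isDivringClosed.Build K (prime_field K) prime_field_divring.

(* The values of v are polynomials so that one variable can be evaluated at 'X,
   which must not occur in the result. *)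
Definition mpoly_values n (v : 'I_n -> {poly K}) : {pred K} :=
  [pred z | `[< exists2 P, P \is a mpolyOver n (prime_field K) &
                z%:P = mmap (@polyC K) v P >]].

Fact mpoly_values_subring n (v : 'I_n -> {poly K}) :
  GRing.subring_closed (mpoly_values v).
Proof.
split=> [|y z|y z].
- by apply/asboolP; exists 1; rewrite ?rpred1 ?rmorph1.
- move=> /asboolP[P kP EP] /asboolP[Q kQ EQ].
  by apply/asboolP; exists (P - Q); rewrite ?rpredB // polyCB EP EQ rmorphB.
- move=> /asboolP[P kP EP] /asboolP[Q kQ EQ].
  by apply/asboolP; exists (P * Q); rewrite ?rpredM // polyCM EP EQ rmorphM.
Qed.
HB.instance Definition _ n (v : 'I_n -> {poly K}) :=
  GRing.isSubringClosed.Build K (mpoly_values v) (mpoly_values_subring v).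

Lemma horner_mmap n (v : 'I_n -> {poly K}) z (P : {mpoly K[n]}) :
  (mmap (@polyC K) v P).[z] = P.@[fun i => (v i).[z]].
Proof.
rewrite mevalE /mmap horner_sum; apply: eq_bigr => m _.
rewrite hornerCM /mmap1 horner_prod; congr (_ * _).
by apply: eq_bigr => i _; rewrite horner_exp.
Qed.

(** An algebraic equation for [z] over the field generated by [t], cleared of denominators, is a
    polynomial relation over the prime field between distinct elements of [S]. *)
Lemma alg_independent_notin_acl (S : {pred K}) U (t : seq K) z :
    alg_independent (prime_field K) S -> uniq (rcons t z) ->
    {subset rcons t z <= S} -> (forall y, U y -> y \in t) ->
  z \notin acl U.
Proof.
move=> indS uniq_tz tzS sUt; apply/negP=> /asboolP az.
pose n := size t.
pose v (i : 'I_n.+1) : {poly K} := if (i < n)%N then (t`_i)%:P else 'X.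
have vz i : (v i).[z] = (rcons t z)`_i.
  rewrite /v nth_rcons -/n; case: ltnP => [_|le_ni]; first by rewrite hornerC.
  by rewrite hornerX eqn_leq le_ni -ltnS ltn_ord.
have {}az : algebraic (quotients (mpoly_values v)) z.
  apply: algebraicS az; apply: gen_field_min => [|y /sUt ty].
    exact: quotients_divring.
  have lt_yn : (index y t < n.+1)%N by rewrite ltnS index_size.
  apply: sub_quotients; apply/asboolP; exists 'X_(Ordinal lt_yn).
    exact: mpolyOverX.
  by rewrite mmapX mmap1U /v /= index_mem ty nth_index.
have [p [/polyOverP Ap p0 pz]] := algebraic_quotients az.
have /choice[P PP] i : exists Q, Q \is a mpolyOver n.+1 (prime_field K) /\
    (p`_i)%:P = mmap (@polyC K) v Q.
  by have /asboolP[Q kQ EQ] := Ap i; exists Q.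
(* The [P i] may contain the last variable, but their images are constants; hence [Q] maps to [p],
   and [Q = 0] forces [p = 0]. *)
pose Q := \sum_(i < size p) P i * 'X_ord_max ^+ i.
have EQ : mmap (@polyC K) v Q = p.
  rewrite rmorph_sum -[RHS]coefK poly_def; apply: eq_bigr => i _.
  rewrite rmorphM rmorphXn /= -(PP i).2 mmapX mmap1U /v ltnn.
  by rewrite mul_polyC.
suff Q0 : Q = 0 by case/eqP: p0; rewrite -EQ Q0 rmorph0.
have szr : size (rcons t z) = n.+1 by rewrite size_rcons.
apply: (indS _ (fun i : 'I_n.+1 => (rcons t z)`_i)).
- by move=> i j /eqP; rewrite nth_uniq ?szr // => /eqP/val_inj.
- by move=> i; apply: tzS; rewrite mem_nth ?szr.
- rewrite rpred_sum // => i _; rewrite rpredM ?(PP i).1 // rpredX //.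
  exact: mpolyOverX.
- by rewrite -[RHS](eqP pz) -[in RHS]EQ horner_mmap; apply: meval_eq => i; rewrite vz.
Qed.

Lemma alg_independent_acl (S : {pred K}) U (t s : seq K) :
    alg_independent (prime_field K) S -> uniq (t ++ s) ->
    {subset t ++ s <= S} -> (forall y, U y -> y \in t) ->
  acl_independent U s.
Proof.
move=> indS; elim: s t U => //= y s IHs t U uniq_ts tsS sUt; split.
  apply: (alg_independent_notin_acl indS _ _ sUt).
    by move: uniq_ts; rewrite -cat_rcons cat_uniq => /andP[].
  by move=> w tw; apply: tsS; rewrite -cat_rcons mem_cat tw.
apply: (IHs (rcons t y)); rewrite ?cat_rcons // => w [->|/sUt tw].
  by rewrite mem_rcons mem_head.
by rewrite mem_rcons inE tw orbT.
Qed.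

Lemma infinite_uniq_seq (S : {pred K}) : (~ exists s : seq K, {subset S <= s}) ->
  forall n, exists s, [/\ size s = n, uniq s & {subset s <= S}].
Proof.
move=> infS; elim=> [|n [s [szs us sS]]]; first by exists [::].
have [x Sx sx] : exists2 x, x \in S & x \notin s.
  apply: contrapT => no_x; apply: infS; exists s => x Sx.
  by apply: contrapT => /negP sx; apply: no_x; exists x.
exists (x :: s); split; rewrite /= ?szs ?sx // => y.
by rewrite inE => /predU1P[->|/sS].
Qed.

(** By [steinitz], [size t + 1] independent elements of [E] cannot all be algebraic over [t]. *)
Lemma infinite_trdeg_notin_acl (E : {pred K}) (t : seq K) :
  infinite_trdeg (prime_field K) E -> exists2 x, x \in E & x \notin acl (fun y => y \in t).
Proof.
case=> S [[SE indS _] infS].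
have [s [szs us sS]] := infinite_uniq_seq infS (size t).+1.
apply: contrapT => noE.
have sind : acl_independent (fun=> False) s.
  exact: (@alg_independent_acl S _ [::]).
suff : (size s <= size t)%N by rewrite szs ltnn.
apply: (steinitz sind) => y /sS/SE Ey.
have ay : y \in acl (fun y => y \in t).
  by apply: contrapT => /negP ny; apply: noE; exists y.
by apply: aclS ay => w tw; apply: sub_acl; right.
Qed.

End PrimeField.

(** * Fixed elements transcendental over an orbit *)

Section ChainClosure.
Variables (K : fieldType) (U : nat -> K -> Prop).
Hypothesis U_le : forall m n y, (m <= n)%N -> U m y -> U n y.

Lemma gen_fieldS (V W : K -> Prop) : (forall y, V y -> W y) ->
  {subset gen_field V <= gen_field W}.
Proof.
move=> sVW; apply: gen_field_min (gen_field_divring W) _ => y /sVW.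
exact: sub_gen_field.
Qed.

Lemma gen_field_chain z : z \in gen_field (fun y => exists m, U m y) ->
  exists m, z \in gen_field (U m).
Proof.
move=> Uz; apply/asboolP; move: z Uz.
apply: (@gen_field_min _ _ [pred z | `[< exists m, z \in gen_field (U m) >]]).
  have both x y : x \in [pred z | `[< exists m, z \in gen_field (U m) >]] ->
      y \in [pred z | `[< exists m, z \in gen_field (U m) >]] ->
    exists m, x \in gen_field (U m) /\ y \in gen_field (U m).
    move=> /asboolP[m Ux] /asboolP[n Uy]; exists (maxn m n); split.
      by apply: gen_fieldS Ux => w; apply: U_le; rewrite leq_maxl.
    by apply: gen_fieldS Uy => w; apply: U_le; rewrite leq_maxr.
  split=> [|x y Ux Uy|x y Ux Uy].
  - by apply/asboolP; exists 0%N; rewrite rpred1.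
  - by have [m [Ux' Uy']] := both x y Ux Uy; apply/asboolP; exists m; rewrite rpredB.
  - by have [m [Ux' Uy']] := both x y Ux Uy; apply/asboolP; exists m; rewrite rpred_div.
by move=> y [m Uy]; apply/asboolP; exists m; apply: sub_gen_field.
Qed.

(** An equation has finitely many coefficients, so all of them appear at one stage of the chain. *)
Lemma acl_chain z : z \in acl (fun y => exists m, U m y) -> exists m, z \in acl (U m).
Proof.
move=> /asboolP[p [/polyOverP Up p0 pz]].
have /choice[m mP] i := gen_field_chain (Up i).
exists (\max_(i < size p) m i); apply/asboolP; exists p; split=> //.
apply/polyOverP=> i; have [le_pi|lt_ip] := leqP (size p) i.
  by rewrite nth_default ?rpred0.
apply: gen_fieldS (mP i) => y; apply: U_le.
exact: (leq_bigmax (Ordinal lt_ip)).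
Qed.

End ChainClosure.

Section Transcendental.
Variables (K : fieldType) (sigma : {rmorphism K -> K}) (a : K).
Hypothesis trdeg_k : infinite_trdeg (prime_field K) (fixed_field sigma).

Definition orbit_of y := exists i, y = iter i sigma a.

Lemma fixed_notin_acl (t : seq K) : {subset t <= fixed_field sigma} ->
  exists2 x, x \in fixed_field sigma & x \notin acl (adjoin_seq orbit_of t).
Proof.
(* Finite windows of the orbit: only finitely many elements can be avoided at once by
   [infinite_trdeg_notin_acl]. *)
move=> tk; pose W m y := y \in t \/ exists2 i, (i < m)%N & y = iter i sigma a.
have fixt w : w \in t -> sigma w = w by move/tk/eqP.
have W_le m n y : (m <= n)%N -> W m y -> W n y.
  move=> le_mn [ty|[i lt_im ->]]; [by left|right; exists i => //].
  exact: leq_trans le_mn.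
have W_out m : exists2 x, x \in fixed_field sigma & x \notin acl (W m).
  have [x kx nx] := infinite_trdeg_notin_acl
    (t ++ [seq iter i sigma a | i <- iota 0 m]) trdeg_k.
  exists x => //; apply: contra nx; apply: aclS => y Wy.
  apply: sub_acl; rewrite mem_cat; case: Wy => [->//|[i lt_im ->]].
  by apply/orP; right; apply/mapP; exists i; rewrite ?mem_iota.
have W_shift n m y : y \in acl (W m) -> iter n sigma y \in acl (W (m + n)%N).
  move=> Wy; elim: n => [|n IHn]; first by rewrite addn0.
  rewrite addnS; apply: rmorph_acl IHn => w [tw|[i lt_im ->]].
    by apply: sub_acl; left; rewrite fixt.
  by apply: sub_acl; right; exists i.+1.
have W_all z : z \in acl (adjoin_seq orbit_of t) -> exists m, z \in acl (W m).
  move=> az; apply: (acl_chain W_le); apply: aclS az => y [[i ->]|ty].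
    by apply: sub_acl; exists i.+1; right; exists i.
  by apply: sub_acl; exists 0%N; left.
(* If some iterate depends on the earlier ones and [t], the closure of that window is stable under
   [sigma] and contains the whole orbit. *)
have [[m am]|nam] := pselect (exists m, iter m sigma a \in acl (W m)).
  have [x kx nx] := W_out m; exists x => //.
  apply: contra nx; apply: aclS => y [[i ->]|ty]; last by apply: sub_acl; left.
  have Wsig z : z \in acl (W m) -> sigma z \in acl (W m).
    apply: rmorph_acl => w [tw|[j lt_jm ->]].
      by apply: sub_acl; left; rewrite fixt.
    rewrite -iterS; have [->//|ne_jm] := eqVneq j.+1 m.
    by apply: sub_acl; right; exists j.+1; rewrite // ltn_neqAle ne_jm.
  elim: i => [|i IHi]; last exact: Wsig.
  case: m am {Wsig} => // m _; by apply: sub_acl; right; exists 0%N.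
(* Otherwise any fixed element transcendental over [t] alone will do. *)
have [x kx nx] := W_out 0%N; exists x => //; apply/negP=> /W_all.
have W_mono m n z : (m <= n)%N -> z \in acl (W m) -> z \in acl (W n).
  by move=> le_mn; apply: aclS => y /(W_le _ _ _ le_mn); apply: sub_acl.
case=> m; elim: m => [|m IHm] Wx; first by rewrite Wx in nx.
(* x lies in the closure of m + 1 consecutive elements of the orbit but not of
   the first m; after exchanging and shifting by m + 1, the element of index
   2m + 1 depends on the previous ones. *)
have {IHm} nWx : x \notin acl (W m) by apply/negP.
have /(@acl_exchange _ _ _ _) : x \in acl (adjoin (iter m sigma a) (W m)).
  apply: aclS Wx => y [ty|[i lt_im ->]]; first by apply: sub_acl; right; left.
  move: lt_im; rewrite ltnS leq_eqVlt => /predU1P[->|lt_im]; apply: sub_acl.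
    by left.
  by right; right; exists i.
move/(_ nWx) => am; apply: nam; exists (m + m.+1)%N.
suff : forall n, iter (m + n)%N sigma a \in
    acl (adjoin x (fun y => y \in t \/ exists2 i, (i < m + n)%N & y = iter i sigma a)).
  move/(_ m.+1); apply: aclS => y [->|[ty|[i lt_im ->]]].
  - by apply: W_mono Wx; rewrite addnS ltnS leq_addl.
  - by apply: sub_acl; left.
  - by apply: sub_acl; right; exists i.
elim=> [|n IHn]; first by rewrite addn0.
rewrite addnS; apply: rmorph_acl IHn => y [->|[ty|[i lt_im ->]]]; apply: sub_acl.
- by left; apply/eqP.
- by right; left; rewrite fixt.
- by right; right; exists i.+1.
Qed.

(** Elements are appended one by one; exchange keeps each earlier entry transcendental after the new
    one joins the others. *)
Lemma fixed_independent n : exists s : seq K, [/\ size s = n,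
  {subset s <= fixed_field sigma} &
  forall i, (i < n)%N ->
    s`_i \notin acl (fun y => orbit_of y \/ exists j, [/\ (j < n)%N, j != i & y = s`_j])].
Proof.
elim: n => [|n [s [szs sk sind]]]; first by exists [::].
have [x kx nx] := fixed_notin_acl sk.
exists (rcons s x); split; first by rewrite size_rcons szs.
  by move=> y; rewrite mem_rcons inE => /predU1P[->|/sk].
have nth_s j : (j < n)%N -> (rcons s x)`_j = s`_j by rewrite nth_rcons szs => ->.
have nth_x : (rcons s x)`_n = x by rewrite nth_rcons szs ltnn eqxx.
move=> i; rewrite ltnS leq_eqVlt => /predU1P[->|lt_in].
  rewrite nth_x; apply: contra nx; apply: aclS => y [Oy|[j [lt_jn ne_jn ->]]].
    by apply: sub_acl; left.
  have {}lt_jn : (j < n)%N by rewrite ltn_neqAle ne_jn.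
  by apply: sub_acl; right; rewrite nth_s // mem_nth ?szs.
rewrite nth_s //.
have nx' : x \notin acl (adjoin s`_i (fun y => orbit_of y \/
    exists j, [/\ (j < n)%N, j != i & y = s`_j])).
  apply: contra nx; apply: aclS => y [->|[Oy|[j [lt_jn _ ->]]]]; apply: sub_acl.
  - by right; rewrite mem_nth ?szs.
  - by left.
  - by right; rewrite mem_nth ?szs.
apply: contra (acl_exchange_notin (sind i lt_in) nx'); apply: aclS.
move=> y [Oy|[j [lt_jn ne_ji ->]]]; apply: sub_acl; first by right; left.
move: lt_jn; rewrite ltnS leq_eqVlt => /predU1P[->|lt_jn]; first by left.
by right; right; exists j; rewrite nth_s.
Qed.

End Transcendental.

(** * The difference equation *)

Lemma infinite_roots (K : fieldType) (p : {poly K}) (r : nat -> K) :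
  injective r -> (forall i, root p (r i)) -> p = 0.
Proof.
move=> r_inj pr; apply/eqP/contraT => p0.
have := @max_poly_roots _ p [seq r i | i <- iota 0 (size p)] p0.
rewrite size_map size_iota ltnn map_inj_uniq // iota_uniq; apply=> //.
by apply/allP=> _ /mapP[i _ ->].
Qed.

Section DifferenceEquation.
Variables (K : fieldType) (sigma : {rmorphism K -> K}) (M : divringClosed K).
Hypothesis sigmaM : forall z, z \in M -> sigma z \in M.
Variables (x a A B : K).
Hypotheses (sigma_x : sigma x = x) (trans_x : ~ algebraic M x).
Hypotheses (Ma : a \in M) (MA : A \in M) (MB : B \in M).
Hypotheses (sigma_a : sigma a != a) (A0 : A != 0).

(** Identities at the transcendental [x] become identities of polynomials, which can then be
    evaluated at points of the orbit. *)
Let poly0 (p : {poly K}) : p \is a polyOver M -> p.[x] = 0 -> p = 0.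
Proof.
move=> Mp px; apply/eqP/contraT => p0; case: trans_x.
by exists p; split=> //; apply/eqP.
Qed.

Let M_iter i z : z \in M -> iter i sigma z \in M.
Proof. by move=> Mz; elim: i => //= i; apply: sigmaM. Qed.

Let xB_neq0 z : z \in M -> x - z != 0.
Proof.
move=> Mz; apply/eqP=> xz; have := @poly0 ('X - z%:P).
rewrite polyOverXsubC Mz hornerXsubC => /(_ isT xz)/eqP.
by rewrite polyXsubC_eq0.
Qed.

(* Summing the equation over the orbit kills the left-hand side, whereas the sum
   of the right-hand sides has a pole at x = a. *)
Lemma difference_eq_finite_orbit n h : (0 < n)%N -> iter n sigma h = h ->
    (forall i, (0 < i < n)%N -> iter i sigma a != a) ->
  sigma h - h <> A * (x - sigma a) / (x - a) - B.
Proof.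
case: n => // n _ nh a_per eq_h.
pose s i := iter i sigma.
have eq_i i : s i.+1 h - s i h =
    s i A * (x - s i.+1 a) / (x - s i a) - s i B.
  elim: i => [|i IHi]; first exact: eq_h.
  move/(congr1 sigma): IHi.
  by rewrite !(rmorphB, rmorphM, fmorphV) /= sigma_x.
have sum0 : \sum_(i < n.+1) (s i A * (x - s i.+1 a) / (x - s i a) - s i B) = 0.
  under eq_bigr do rewrite -eq_i.
  rewrite -(big_mkord xpredT (fun i => s i.+1 h - s i h)) telescope_sumr //.
  by rewrite /s nh subrr.
(* [num i] is the numerator of the summand of index [i] over ['X - s i a], and [R] that of the whole
   sum over the product of these denominators. *)
pose num i := (s i A)%:P * ('X - (s i.+1 a)%:P) - (s i B)%:P * ('X - (s i a)%:P).
pose R := \sum_(i < n.+1) num i * \prod_(k < n.+1 | k != i) ('X - (s k a)%:P).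
have Rx : R.[x] = 0.
  rewrite -[RHS](mulr0 (\prod_(k < n.+1) (x - s k a))) -[in RHS]sum0 mulr_sumr.
  rewrite horner_sum; apply: eq_bigr => i _.
  rewrite hornerM horner_prod [in RHS](bigD1 i) //= mulrAC; congr (_ * _).
    rewrite !hornerE; field; exact/xB_neq0/M_iter.
  by apply: eq_bigr => k _; rewrite hornerXsubC.
have MR : R \is a polyOver M.
  rewrite rpred_sum // => i _; rewrite rpredM //.
    by rewrite rpredB // rpredM ?polyOverXsubC ?polyOverC // ?M_iter.
  by rewrite rpred_prod // => k _; rewrite polyOverXsubC M_iter.
(* At [a] every term of index [i > 0] contains the factor ['X - a]. The term of index 0 is
   [A * (a - sigma a)] times the differences [a - s k a] with [k > 0], all nonzero. *)
have /eqP := congr1 (horner^~ a) (poly0 MR Rx).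
rewrite horner0 horner_sum big_ord_recl [X in _ + X]big1 => [|i _]; last first.
  by rewrite hornerM horner_prod (bigD1 ord0) //= hornerXsubC subrr mul0r mulr0.
rewrite addr0 hornerM !hornerE subrr mulr0 subr0 mulf_eq0 mulf_eq0 (negPf A0).
rewrite subr_eq0 eq_sym (negPf sigma_a) horner_prod /= => /prodf_eq0[k k0].
rewrite hornerXsubC subr_eq0 eq_sym; apply/negP/a_per.
by rewrite lt0n k0 ltn_ord.
Qed.

Hypothesis sigma_bij : bijective sigma.

(** The pole of the right-hand side at [a] forces a root of the reduced denominator of [h] at [a] or
    at its preimage. From [a] roots propagate forwards along the orbit, from the preimage backwards,
    so there would be infinitely many. *)
Lemma difference_eq_infinite_orbit h : h \in quotients (poly_values M x) ->
    (forall i, (0 < i)%N -> iter i sigma a != a) ->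
  sigma h - h <> A * (x - sigma a) / (x - a) - B.
Proof.
have [tau sigmaK tauK] := sigma_bij.
move=> /asboolP[_ [_ [/asboolP[u Mu ->] /asboolP[v Mv ->] vx0 ->]]] a_per eq_h.
(* As [x] is fixed, [sigma] acts on polynomial values at [x] through the coefficients. *)
pose s := map_poly sigma.
have sx p : sigma p.[x] = (s p).[x] by rewrite -[x in RHS]sigma_x horner_map.
have Ms p : p \is a polyOver M -> s p \is a polyOver M.
  by move=> /polyOverP Mp; apply/polyOverP=> i; rewrite coef_map; apply: sigmaM.
pose e := A%:P * ('X - (sigma a)%:P) - B%:P * ('X - a%:P).
have Me : e \is a polyOver M.
  by rewrite rpredB // rpredM ?polyOverXsubC ?polyOverC // sigmaM.
have svx0 : (s v).[x] != 0 by rewrite -sx fmorph_eq0.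
have eq_uv : (s u * v - u * s v) * ('X - a%:P) - v * s v * e = 0.
  apply: poly0.
    apply: rpredB; apply: rpredM; rewrite ?polyOverXsubC ?Me //.
      by rewrite rpredB // rpredM ?Ms.
    by rewrite rpredM ?Ms.
  move: eq_h; rewrite fmorph_div !sx => eq_h.
  have xa0 := xB_neq0 Ma.
  rewrite /e !hornerE.
  transitivity ((v.[x] * (s v).[x] * (x - a)) *
    ((s u).[x] / (s v).[x] - u.[x] / v.[x] - (A * (x - sigma a) / (x - a) - B))).
    by field; rewrite xa0 vx0 svx0.
  by rewrite eq_h subrr mulr0.
have v0 : v != 0 by apply: contraNneq vx0 => ->; rewrite horner0.
pose g := gcdp u v; pose u1 := u %/ g; pose v1 := v %/ g.
have Eu : u = u1 * g by rewrite divpK ?dvdp_gcdl.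
have Ev : v = v1 * g by rewrite divpK ?dvdp_gcdr.
have g0 : g != 0 by rewrite gcdp_eq0 negb_and v0 orbT.
have v10 : v1 != 0 by move: v0; rewrite Ev mulf_eq0 negb_or => /andP[].
have co_uv : coprimep u1 v1 by rewrite coprimep_div_gcd // v0 orbT.
have sg0 : s g != 0 by rewrite map_poly_eq0.
have {eq_uv} eq1 : (s u1 * v1 - u1 * s v1) * ('X - a%:P) = v1 * s v1 * e.
  have gg0 : g * s g != 0 by rewrite mulf_neq0.
  apply/(mulfI gg0)/eqP; rewrite -subr_eq0 -[X in _ == X]eq_uv.
  rewrite Eu Ev /s !rmorphM /=; apply/eqP; ring.
have u1_nroot y : root v1 y -> u1.[y] != 0.
  by move=> vy; apply: contraL vy => uy; apply: (coprimep_root co_uv).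
have ss p y : (s p).[sigma y] = sigma p.[y] by rewrite horner_map.
(* At [sigma y] the factor [s v1] vanishes, while [s u1] does not by coprimality; only [v1] or
   ['X - a] can make the left side zero. *)
have forward y : root v1 y -> ~~ root v1 (sigma y) -> sigma y = a.
  move=> vy; rewrite rootE => nvy; have := congr1 (horner^~ (sigma y)) eq1.
  rewrite !hornerM hornerXsubC hornerD hornerN !hornerM !ss (eqP vy) rmorph0.
  rewrite !(mulr0, mul0r) subr0 => /eqP; rewrite !mulf_eq0 fmorph_eq0.
  by rewrite (negPf (u1_nroot y vy)) (negPf nvy) subr_eq0 => /eqP.
have backward y : root v1 (sigma y) -> ~~ root v1 y -> sigma y = a.
  move=> vy; rewrite rootE => nvy; have := congr1 (horner^~ (sigma y)) eq1.
  rewrite !hornerM hornerXsubC hornerD hornerN !hornerM !ss (eqP vy).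
  rewrite !(mulr0, mul0r) sub0r => /eqP; rewrite mulf_eq0 oppr_eq0 mulf_eq0.
  by rewrite (negPf (u1_nroot _ vy)) fmorph_eq0 (negPf nvy) subr_eq0 => /eqP.
have iter_inj (f : K -> K) : injective f ->
    (forall i, (0 < i)%N -> iter i f a != a) -> injective (fun i => iter i f a).
  move=> f_inj f_per.
  have step i k : (0 < k)%N -> iter (i + k) f a = iter i f a -> False.
    move=> k0; elim: i => [|i IHi]; first exact/eqP/f_per.
    by rewrite addSn !iterS => /f_inj.
  move=> i j; have [lt_ij|lt_ji|->//] := ltngtP i j => eq_ij.
    by case: (@step i (j - i)%N); rewrite ?subn_gt0 ?subnKC // ltnW.
  by case: (@step j (i - j)%N); rewrite ?subn_gt0 ?subnKC // ltnW.
have sigma_inj : injective sigma := can_inj sigmaK.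
have iterK i y : iter i sigma (iter i tau y) = y.
  by elim: i y => // i IHi y; rewrite iterSr iterS tauK IHi.
have tau_per i : (0 < i)%N -> iter i tau a != a.
  by move=> i0; apply: contra (a_per i i0) => /eqP ti; rewrite -{1}ti iterK.
(* At [a] the left side of [eq1] vanishes and [e] does not, so [v1] has the root [a] or [tau a]. *)
have /eqP := congr1 (horner^~ a) eq1.
rewrite !hornerM hornerXsubC subrr mulr0 eq_sym mulf_eq0 mulf_eq0.
have -> : e.[a] == 0 = false.
  rewrite /e !hornerE subrr mulr0 subr0 mulf_eq0 (negPf A0) subr_eq0 eq_sym.
  exact: negPf sigma_a.
rewrite orbF -{2}(tauK a) ss fmorph_eq0 => /orP[va|vta]; case/eqP: v10.
  apply: (infinite_roots (iter_inj _ sigma_inj a_per)).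
  elim=> [//|i IHi]; apply: contraT => /(forward _ IHi) /eqP.
  by rewrite -iterS (negPf (a_per _ _)).
have r_inj : injective (fun i => iter i.+1 tau a).
  by move=> i j /(iter_inj _ (can_inj tauK) tau_per)[].
apply: (infinite_roots r_inj); elim=> [//|i IHi].
apply: contraT; rewrite [iter i.+2 tau a]iterS => /(backward (tau _)).
by rewrite tauK => /(_ IHi)/eqP; rewrite (negPf (tau_per _ _)).
Qed.

End DifferenceEquation.

(** * Free subgroups on two generators *)

Section FreePair.
Local Open Scope group_scope.
Variables (G : groupType) (u v : G).
Hypothesis uv : u != v.
Implicit Types (w : seq (G * bool)) (l : G * bool).

Definition letter_inv l := (l.1, ~~ l.2).

Lemma letter_val_inv l : letter_val (letter_inv l) = (letter_val l)^-1.
Proof. by case: l => x []; rewrite /letter_val //= invgK. Qed.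

Lemma word_val_cons l w : word_val (l :: w) = letter_val l * word_val w.
Proof. exact: big_cons. Qed.

Definition cancel_word w1 w2 := catrev (map letter_inv w1) w2.

Lemma word_val_cancel w1 w2 :
  word_val (cancel_word w1 w2) = (word_val w1)^-1 * word_val w2.
Proof.
rewrite /cancel_word; elim: w1 w2 => [|l w1 IHw] w2 /=.
  by rewrite /word_val big_nil invg1 mul1g.
by rewrite IHw !word_val_cons letter_val_inv invgM mulgA.
Qed.

Lemma word_on_cancel (X : {pred G}) w1 w2 :
  word_on X w1 -> word_on X w2 -> word_on X (cancel_word w1 w2).
Proof.
rewrite /cancel_word; elim: w1 w2 => //= l w1 IHw w2 /andP[Xl Xw1] Xw2.
by apply: IHw => //=; rewrite Xl.
Qed.

Lemma reduced_cons l w : reduced (l :: w) =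
  (if w is m :: _ then m != letter_inv l else true) && reduced w.
Proof.
case: w => [|m w] //=; congr (_ && _); rewrite -pair_eqE /= [m.1 == _]eq_sym.
by case: (l.1 == m.1) (l.2) (m.2) => [] [] [].
Qed.

(** The only new junction joins the inverse of the first letter of [w1] to the first letter of
    [w2]. *)
Lemma reduced_cancel w1 w2 : reduced w1 -> reduced w2 ->
    (if (w1, w2) is (l1 :: _, l2 :: _) then l1 != l2 else true) ->
  reduced (cancel_word w1 w2).
Proof.
rewrite /cancel_word; elim: w1 w2 => [//|l w1 IHw] w2.
rewrite reduced_cons => /andP[hw1 rw1] rw2 hw2; apply: IHw => //.
rewrite reduced_cons rw2 andbT; case: w2 hw2 {rw2} => // l2 w2.
by rewrite eq_sym /letter_inv /= negbK -surjective_pairing.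
Qed.

(** A letter put before a reduced word either cancels its first letter or leaves it reduced. *)
Lemma reduced_word (X : {pred G}) w : word_on X w ->
  exists w', [/\ word_on X w', reduced w' & word_val w' = word_val w].
Proof.
elim: w => [|l w IHw] /=; first by exists [::].
case/andP=> Xl /IHw[w' [Xw' rw' vw']].
have [[w2 Ew']|nE] := pselect (exists w2, w' = letter_inv l :: w2).
  exists w2.
  move: Xw' rw' vw'; rewrite Ew' reduced_cons !word_val_cons => /andP[_ Xw2] /andP[_ rw2] <-.
  by split=> //; rewrite letter_val_inv mulVKg.
exists (l :: w'); split; [by rewrite /= Xl| |by rewrite !word_val_cons vw'].
rewrite reduced_cons rw' andbT; case: w' nE {Xw' rw' vw'} => // m w' nE.
by apply/eqP=> Em; apply: nE; exists w'; rewrite Em.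
Qed.

Hypothesis word_neq1 : forall w,
  word_on (pred2 u v) w -> reduced w -> word_val w = 1 -> w = [::].

(** After common first letters are stripped, the word for [w1^-1 w2] is reduced with value 1, and
    nonempty unless both words are exhausted. *)
Lemma reduced_word_inj w1 w2 : word_on (pred2 u v) w1 -> word_on (pred2 u v) w2 ->
  reduced w1 -> reduced w2 -> word_val w1 = word_val w2 -> w1 = w2.
Proof.
elim: w1 w2 => [|l1 w1 IHw] [|l2 w2] //.
- by move=> _ Xw2 _ rw2 /esym w21; rewrite (word_neq1 Xw2 rw2) // w21 /word_val big_nil.
- by move=> Xw1 _ rw1 _ w11; rewrite (word_neq1 Xw1 rw1) // w11 /word_val big_nil.
move=> Xw1 Xw2 rw1 rw2 eqw; have [El|ne_l] := eqVneq l1 l2.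
  move: Xw1 Xw2 rw1 rw2 eqw; rewrite El !reduced_cons !word_val_cons /=.
  move=> /andP[_ Xw1] /andP[_ Xw2] /andP[_ rw1] /andP[_ rw2] /mulgI eqw.
  by rewrite (IHw w2).
have /(congr1 size) : cancel_word (l1 :: w1) (l2 :: w2) = [::].
  apply: word_neq1; first exact: word_on_cancel.
    exact: reduced_cancel.
  by rewrite word_val_cancel eqw mulVg.
by rewrite /cancel_word catrevE size_cat addnS.
Qed.

Theorem free_noncyclic_subgroup :
  exists H : {pred G}, [/\ group_closed H, is_free H & ~ is_cyclic H].
Proof.
pose H : {pred G} :=
  [pred g | `[< exists2 w, word_on (pred2 u v) w & word_val w = g >]].
have Xu : u \in pred2 u v by rewrite inE eqxx.
have Xv : v \in pred2 u v by rewrite inE eqxx orbT.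
have H1 x : x \in pred2 u v -> x \in H.
  move=> Xx; apply/asboolP; exists [:: (x, false)]; first by rewrite /= Xx.
  by rewrite /word_val big_seq1.
exists H; split.
- split=> [|x y /asboolP[w1 Xw1 <-] /asboolP[w2 Xw2 <-]]; apply/asboolP.
    by exists [::] => //; rewrite /word_val big_nil.
  (* [cancel_word w [::]] spells the inverse of [w], so this word has value [x * y^-1]. *)
  exists (cancel_word (cancel_word w1 [::]) (cancel_word w2 [::])).
    by rewrite !word_on_cancel.
  by rewrite !word_val_cancel /word_val big_nil !mulg1 invgK.
- exists (pred2 u v : {pred G}); split=> [x /H1|h /asboolP[w Xw <-]] //.
  have [w' [Xw' rw' vw']] := reduced_word Xw.
  exists w'; split=> [//|w2 [Xw2 rw2 vw2]].
  by apply: reduced_word_inj; rewrite ?vw2.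
case=> g gen_g.
have gH h : h \in H -> commute g h.
  case/gen_g=> n [->|->]; first exact: commuteX.
  exact/commuteV/commuteX.
(* A cyclic group is commutative, which would give two distinct reduced words with the same
   value. *)
have cuv : u * v = v * u.
  case/gen_g: (H1 u Xu) => n [->|->].
    exact/commute_sym/commuteX/commute_sym/gH/H1.
  exact/commute_sym/commuteV/commuteX/commute_sym/gH/H1.
have [] : [:: (u, false); (v, false)] = [:: (v, false); (u, false)].
  apply: reduced_word_inj; rewrite /= ?(Xu, Xv, negPf uv) ?[v == u]eq_sym ?(negPf uv) //.
  by rewrite !word_val_cons /letter_val /= /word_val big_nil !mulg1.
by move/eqP; rewrite (negPf uv).
Qed.

End FreePair.

(** * Products of linear factors *)

Section LinearFactors.
Variables (K : fieldType) (sigma : {rmorphism K -> K}) (F : divringClosed K).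
Hypothesis sigmaF : forall z, z \in F -> sigma z \in F.
Variables (D : divisionRingType) (f : {rmorphism skew_poly sigma -> D}).
Hypothesis f_inj : injective f.

Definition opp_letter (l : bool * bool) := (l.1, ~~ l.2).

Variable c : bool * bool -> K.
Hypothesis Fc : forall l, c l \in F.
(** The expression is the leading coefficient obtained when [P j] multiplies a relation whose two
    longest tails start with [(P j)^-1] and [(P l)^-1]. *)
Hypothesis c_unsolvable : forall j l psi, psi \in F -> j != opp_letter l ->
  c (opp_letter l) - c l + (c j * psi - c l * sigma psi) != 0.
Implicit Types (l : bool * bool) (w : seq (bool * bool)) (z : D).

Let iota a : D := f (skewC sigma a).
Let T : D := f (skewX sigma).

Let iotaM a b : iota (a * b) = iota a * iota b.
Proof.
rewrite /iota -rmorphM; congr (f _).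
by rewrite skewC_mul /skewC -[RHS]mul_polyC polyCM.
Qed.
Let iotaD a b : iota (a + b) = iota a + iota b.
Proof. by rewrite /iota -rmorphD /skewC polyCD. Qed.
Let iotaN a : iota (- a) = - iota a.
Proof. by rewrite /iota -rmorphN /skewC polyCN. Qed.
Let iota0 : iota 0 = 0.
Proof. by rewrite /iota /skewC polyC0 rmorph0. Qed.
Let iota1 : iota 1 = 1.
Proof. by rewrite -(rmorph1 f). Qed.
Let T_iota a : T * iota a = iota (sigma a) * T.
Proof. by rewrite /T /iota -!rmorphM skewX_C. Qed.

Definition linear_factor l : D := iota (c l) - T.
Local Notation P := linear_factor.

Lemma linear_factor_neq0 l : P l != 0.
Proof.
rewrite /P /iota /T -rmorphB -(rmorph0 f) (inj_eq f_inj).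
apply/eqP=> /(congr1 (fun p : {poly K} => p`_1)).
by rewrite coefB coefC coefX coef0 sub0r => /eqP; rewrite oppr_eq0 oner_eq0.
Qed.

Lemma linear_factor_unit l : P l \is a GRing.unit.
Proof. exact/neq0_unit/linear_factor_neq0. Qed.

(** Multiplying by [c l - t] raises the degree by one and sends the leading coefficient to minus its
    image under [sigma]. *)
Lemma linear_factor_not_unit_poly l p : P l * f p <> 1.
Proof.
rewrite /P /iota /T -rmorphB -rmorphM -(rmorph1 f) => /f_inj.
have [->|p0] := eqVneq (p : {poly K}) 0.
  by rewrite mulr0 => /eqP; rewrite eq_sym oner_eq0.
have [n szp] : exists n, size (p : {poly K}) = n.+1.
  by exists (size (p : {poly K})).-1; rewrite polySpred.
move/(congr1 (fun p : {poly K} => p`_n.+1)); rewrite [RHS]coefC.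
rewrite [LHS](coef_skew_mul sigma (skewC sigma (c l) - skewX sigma) p).
rewrite 2!big_ord_recl big1 => [|i _]; last first.
  by rewrite coefB coefC coefX /= subr0 mul0r.
rewrite !coefB !coefC !coefX /= subn0 subSS subn0 nth_default ?szp // mulr0.
rewrite add0r addr0 sub0r mulN1r => /eqP; rewrite oppr_eq0 fmorph_eq0.
by move: p0; rewrite -lead_coef_eq0 /lead_coef szp => /negPf->.
Qed.

Lemma linear_factor_iota l a :
  P l * iota a = iota (c l * a) - iota (sigma a) * T.
Proof. by rewrite mulrBl -iotaM T_iota. Qed.

Fixpoint word_prod w : D :=
  if w is l :: v then P (opp_letter l) * ((P l)^-1 * word_prod v) else 1.

Definition tail_prod l w := (P l)^-1 * word_prod w.

(** Combinations of the tails of [w] with coefficients in [F], modulo all of [K[t; sigma]]. *)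
Fixpoint tail_span w z : Prop :=
  if w is l :: v then exists a z', [/\ a \in F, tail_span v z' &
    z = iota a * tail_prod l v + z'] else exists p, z = f p.

Lemma tail_spanD w z1 z2 : tail_span w z1 -> tail_span w z2 -> tail_span w (z1 + z2).
Proof.
elim: w z1 z2 => [|l w IHw] z1 z2 /=.
  by move=> [p ->] [q ->]; exists (p + q); rewrite rmorphD.
move=> [a [z1' [Fa sz1 ->]]] [b [z2' [Fb sz2 ->]]].
exists (a + b), (z1' + z2'); split; [exact: rpredD|exact: IHw|].
by rewrite iotaD mulrDl addrACA.
Qed.

Lemma tail_spanZ w a z : a \in F -> tail_span w z -> tail_span w (iota a * z).
Proof.
move=> Fa; elim: w z => [|l w IHw] z /=.
  by move=> [p ->]; exists (skewC sigma a * p); rewrite rmorphM.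
move=> [b [z' [Fb sz ->]]].
exists (a * b), (iota a * z'); split; [exact: rpredM|exact: IHw|].
by rewrite mulrDr mulrA iotaM.
Qed.

Lemma tail_span_cons l w z : tail_span w z -> tail_span (l :: w) z.
Proof.
by move=> sz; exists 0, z; split; rewrite ?rpred0 // iota0 mul0r add0r.
Qed.

Lemma tail_span_poly w p : tail_span w (f p).
Proof. by elim: w => [|l w IHw]; [exists p|apply: tail_span_cons]. Qed.

(** [P (opp_letter l)] and [P l] differ by a constant, since [t] cancels. *)
Lemma word_prod_cons l w : word_prod (l :: w) =
  iota (c (opp_letter l) - c l) * tail_prod l w + word_prod w.
Proof.
have -> : iota (c (opp_letter l) - c l) = P (opp_letter l) - P l.
  by rewrite iotaD iotaN /P opprB addrA subrK.
by rewrite mulrBl /tail_prod [P l * _]mulrA divrr ?linear_factor_unit // mul1r subrK.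
Qed.

Lemma tail_span_word_prod w : tail_span w (word_prod w).
Proof.
elim: w => [|l w IHw]; first by exists 1; rewrite rmorph1.
by rewrite word_prod_cons; exists (c (opp_letter l) - c l), (word_prod w);
   split; rewrite ?rpredB.
Qed.

(** After [t] is moved past [a] and written as [c l - P l], the factor [P l] cancels the inverse
    that starts the tail. *)
Lemma linear_factor_tail_prod j l w a : P j * (iota a * tail_prod l w) =
  iota (c j * a - c l * sigma a) * tail_prod l w + iota (sigma a) * word_prod w.
Proof.
rewrite mulrA linear_factor_iota.
have -> : T = iota (c l) - P l by rewrite /P opprB addrC subrK.
rewrite mulrBr opprB -iotaM addrA addrAC mulrDl iotaD iotaN [sigma a * _]mulrC.
congr (_ + _); rewrite -mulrA /tail_prod [P l * _]mulrA.
by rewrite divrr ?linear_factor_unit // mul1r.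
Qed.

Lemma tail_span_linear_factor j w z : tail_span w z -> tail_span w (P j * z).
Proof.
elim: w z => [|l w IHw] z.
  move=> [p ->]; exists ((skewC sigma (c j) - skewX sigma) * p).
  by rewrite rmorphM rmorphB.
move=> [a [z' [Fa sz ->]]]; rewrite mulrDr linear_factor_tail_prod -addrA.
exists (c j * a - c l * sigma a), (iota (sigma a) * word_prod w + P j * z').
split=> //; first by rewrite rpredB ?rpredM ?sigmaF.
apply: tail_spanD; last exact: IHw.
by apply: tail_spanZ (tail_span_word_prod _); apply: sigmaF.
Qed.

(** Dividing by a nonzero leading coefficient reduces independence to relations with leading
    coefficient 1. *)
Lemma tail_prod_normalise l w : (forall z, tail_span w z -> tail_prod l w + z <> 0) ->
  forall a z, a \in F -> tail_span w z -> iota a * tail_prod l w + z = 0 -> a = 0.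
Proof.
move=> not0 a z Fa sz eq0; apply/eqP/contraT => a0; exfalso.
apply: (not0 (iota a^-1 * z)); first by apply: tail_spanZ; rewrite ?rpredV.
rewrite -(mulr0 (iota a^-1)) -eq0 mulrDr mulrA -iotaM mulVf // iota1.
by rewrite mul1r.
Qed.

(* Multiplying the relation by P l on the left removes the longest tail and yields
   a shorter relation, whose leading coefficient is nonzero by hypothesis. *)
Lemma tail_prod_independent l w a z : sorted [rel j m | j != opp_letter m] (l :: w) ->
  a \in F -> tail_span w z -> iota a * tail_prod l w + z = 0 -> a = 0.
Proof.
move=> red_w; move: a z; apply: tail_prod_normalise.
elim: w l red_w => [|m w IHw] l red_w z sz /(congr1 (fun y => P l * y));
  rewrite mulr0 mulrDr mulVKr ?linear_factor_unit //.
  (* No shorter tail is left: the relation would make [P l] invertible on the right among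
     polynomials. *)
  case: sz => p ->; rewrite /= addrC => /eqP; rewrite addr_eq0 => /eqP eq1.
  by apply: (@linear_factor_not_unit_poly l (- p)); rewrite rmorphN mulrN eq1 opprK.
case: sz => a [z' [Fa sz ->]] eq0.
move: red_w => /= /andP[ne_lm red_w].
have /eqP := c_unsolvable Fa ne_lm; apply.
have IH := tail_prod_normalise (IHw m red_w).
apply: (IH _ (word_prod w + (iota (sigma a) * word_prod w + P l * z'))) => //.
- by rewrite rpredD ?rpredB ?rpredM ?sigmaF.
- apply: tail_spanD; first exact: tail_span_word_prod.
  apply: tail_spanD; last exact: tail_span_linear_factor.
  by apply: tail_spanZ (tail_span_word_prod _); apply: sigmaF.
rewrite -[RHS]eq0 word_prod_cons mulrDr linear_factor_tail_prod iotaD mulrDl.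
by rewrite !addrA; congr (_ + _ + _); rewrite addrAC.
Qed.

(** Value 1 would be a relation with leading coefficient [c (opp_letter l) - c l], which is nonzero
    by [c_unsolvable] at [psi = 0]. *)
Lemma word_prod_neq1 l w : sorted [rel j m | j != opp_letter m] (l :: w) ->
  word_prod (l :: w) <> 1.
Proof.
move=> red_w /eqP; rewrite -subr_eq0 word_prod_cons -addrA => /eqP eq0.
have ne_l : l != opp_letter l by case: l {red_w eq0} => [[] []].
have := c_unsolvable (rpred0 F) ne_l.
rewrite rmorph0 !mulr0 subrr addr0 => /eqP; apply.
apply: tail_prod_independent red_w _ _ eq0; first by rewrite rpredB.
apply: tail_spanD; first exact: tail_span_word_prod.
by rewrite -(rmorph1 f) -rmorphN; apply: tail_span_poly.
Qed.

Definition generator b : nonzero D :=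
  nz_mul (exist _ (P (b, true)) (linear_factor_neq0 _))
    (nz_inv (exist _ (P (b, false)) (linear_factor_neq0 _))).

Lemma generatorE b e : val (letter_val (generator b, e)) =
  P (opp_letter (b, e)) * (P (b, e))^-1.
Proof.
case: e => //=.
by rewrite invrM ?unitrV ?linear_factor_unit // invrK.
Qed.

(** Were they equal, the product of the first by the inverse of the second would be a word without
    adjacent opposite letters and of value 1. *)
Lemma generator_neq : generator false != generator true.
Proof.
apply/eqP=> Eg; have := @word_prod_neq1 (false, false) [:: (true, true)] isT; apply.
rewrite /= mulr1 mulrA -!/(P _) -(generatorE false false) -(generatorE true true).
by rewrite Eg /letter_val /= divrr ?neq0_unit ?(valP (generator true)).
Qed.

Definition letter_code (l : nonzero D * bool) := (l.1 == generator true, l.2).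

Lemma generator_word (w : seq (nonzero D * bool)) :
    word_on (pred2 (generator false) (generator true)) w ->
  val (word_val w) = word_prod (map letter_code w).
Proof.
elim: w => [|[x e] w IHw]; first by rewrite /word_val big_nil.
move=> /= /andP[Xx /IHw eqw]; rewrite word_val_cons [LHS]/= eqw mulrA; congr (_ * _).
case/pred2P: Xx => /= ->; rewrite /letter_code /= ?eqxx ?(negPf generator_neq);
exact: generatorE.
Qed.

Theorem linear_factors_free_subgroup :
  exists H : {pred nonzero D}, [/\ group_closed H, is_free H & ~ is_cyclic H].
Proof.
apply: (free_noncyclic_subgroup generator_neq) => -[//|l w] Xw red_w w1.
have /(congr1 val) := w1; rewrite generator_word // => /word_prod_neq1; case.
rewrite -[_ :: _]/(map letter_code (l :: w)) sorted_map.
(* The generators being distinct, the coding by booleans preserves reducedness. *)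
apply: sub_in_sorted Xw red_w => -[x d] [y e] /pred2P[]/= -> /pred2P[]/= ->;
  rewrite /letter_code /opp_letter /= ?eqxx ?(negPf generator_neq) //.
all: by case: d e => [] [].
Qed.

End LinearFactors.

(** * Choice of the coefficients *)

Section Coefficients.
Variables (K : fieldType) (sigma : {rmorphism K -> K}) (a : K).
Hypothesis sigma_bij : bijective sigma.
Hypothesis sigma_a : sigma a != a.

Definition letter_index (l : bool * bool) : nat := (l.1.*2 + l.2)%N.

Variable s : seq K.
Hypothesis s_fixed : {subset s <= fixed_field sigma}.
Hypothesis size_s : size s = 4%N.
Hypothesis s_indep : forall i, (i < 4)%N ->
  s`_i \notin acl (fun y => orbit_of sigma a y \/
                     exists j, [/\ (j < 4)%N, j != i & y = s`_j]).
Implicit Types (l m : bool * bool).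

Definition coefficient_field : {pred K} :=
  gen_field (fun y => orbit_of sigma a y \/ y \in s).
Local Notation F := coefficient_field.
HB.instance Definition _ :=
  GRing.isDivringClosed.Build K F (gen_field_divring _).

Let x l := s`_(letter_index l).
(** The field [M] of the difference equation: it is stable under [sigma], and being algebraically
    closed in [K] it has [x l] transcendental over it. *)
Let others l : {pred K} := acl (fun y => orbit_of sigma a y \/
   exists j, [/\ (j < 4)%N, j != letter_index l & y = s`_j]).

(* c l = sigma (g l) / g l for g l = x l - a, so that c j psi - c l sigma(psi) is
   equivalent to h - sigma h with h = g l psi / g j. *)
Definition letter_coefficient l := (x l - sigma a) / (x l - a).
Local Notation c := letter_coefficient.

Let letter_index_lt l : (letter_index l < 4)%N.
Proof. by case: l => [[] []]. Qed.

Let letter_index_inj l m : (letter_index l == letter_index m) = (l == m).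
Proof. by case: l m => [[] []] [[] []]. Qed.

Let s_mem i : (i < 4)%N -> s`_i \in s.
Proof. by move=> lt_i4; rewrite mem_nth ?size_s. Qed.

Let sigma_s y : y \in s -> sigma y = y.
Proof. by move/s_fixed/eqP. Qed.

Let sigma_x l : sigma (x l) = x l.
Proof. exact/sigma_s/s_mem. Qed.

Let F_orbit i : iter i sigma a \in F.
Proof. by apply: sub_gen_field; left; exists i. Qed.

Let F_x l : x l \in F.
Proof. by apply: sub_gen_field; right; apply: s_mem. Qed.

Let others_orbit l i : iter i sigma a \in others l.
Proof. by apply: sub_acl; left; exists i. Qed.

Let others_x l m : m != l -> x m \in others l.
Proof.
by move=> ne_ml; apply: sub_acl; right; exists (letter_index m); rewrite letter_index_inj.
Qed.

Let x_others l : x l \notin others l.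
Proof. exact: s_indep. Qed.

Lemma coefficient_field_stable z : z \in F -> sigma z \in F.
Proof.
apply: (@rmorph_gen_field _ _ _ F) => y [[i ->]|sy].
  exact: (F_orbit i.+1).
by apply: sub_gen_field; right; rewrite sigma_s.
Qed.

Let sigma_others l z : z \in others l -> sigma z \in others l.
Proof.
apply: rmorph_acl => y [[i ->]|[j [lt_j4 ne_jl ->]]]; first exact: (others_orbit l i.+1).
by apply: sub_acl; right; exists j; rewrite sigma_s ?s_mem.
Qed.

Let xB_neq0 l : x l - a != 0.
Proof.
rewrite subr_eq0; apply: contraNneq (x_others l) => ->; exact: (others_orbit l 0).
Qed.

Let xBs_neq0 l : x l - sigma a != 0.
Proof. by rewrite -(sigma_x l) -rmorphB fmorph_eq0. Qed.

Lemma letter_coefficient_in l : c l \in F.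
Proof. by rewrite rpred_div // rpredB // ?(F_orbit 1) ?(F_orbit 0). Qed.

(** The elements fixed by the [n]-th iterate of [sigma] form a subfield containing the generators of
    [F]. *)
Lemma iter_fixed_F n z : iter n sigma a = a -> z \in F -> iter n sigma z = z.
Proof.
move=> na Fz; apply/eqP; move: z Fz.
apply: (@gen_field_min _ _ [pred z | iter n sigma z == z]).
  have iterB y z : iter n sigma (y - z) = iter n sigma y - iter n sigma z.
    by elim: n {na} => //= n ->; rewrite rmorphB.
  have iterV y z : iter n sigma (y / z) = iter n sigma y / iter n sigma z.
    by elim: n {na iterB} => //= n ->; rewrite fmorph_div.
  split=> [|y z|y z]; rewrite !inE; first by rewrite siter1.
    by rewrite iterB => /eqP-> /eqP->.
  by rewrite iterV => /eqP-> /eqP->.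
move=> y [[i ->]|sy]; rewrite inE; first by rewrite -iterD addnC iterD na.
by elim: n {na} => //= n /eqP->; rewrite sigma_s.
Qed.

Lemma letter_coefficient_unsolvable (j : bool * bool) l psi : psi \in F -> j != opp_letter l ->
  c (opp_letter l) - c l + (c j * psi - c l * sigma psi) != 0.
Proof.
move=> Fpsi ne_jl; apply/eqP=> eq0; set m := opp_letter l.
have ne_lm : l != m by rewrite /m; case: l {ne_jl eq0 m} => [[] []].
(* Multiplying [eq0] by [A] turns [c j * psi] into [h], [c l * sigma psi] into [sigma h] and [c l]
   into [B]. As [j] and [l] differ from [m], both [A] and [B] avoid [x m]. *)
pose A := (x l - a) / (x j - sigma a).
pose B := (x l - sigma a) / (x j - sigma a).
pose h := (x l - a) * psi / (x j - a).
have eq_h : sigma h - h = A * (x m - sigma a) / (x m - a) - B.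
  rewrite -[LHS]addr0 -[in LHS](mulr0 A) -[in LHS]eq0 /h /A /B /c.
  rewrite fmorph_div rmorphM !rmorphB !sigma_x -/m.
  by field; rewrite !xB_neq0 !xBs_neq0.
have MB : B \in others m.
  by rewrite rpred_div ?rpredB ?others_x ?(others_orbit m 1).
have MA : A \in others m.
  by rewrite rpred_div ?rpredB ?others_x ?(others_orbit m 1) ?(others_orbit m 0).
have A0 : A != 0 by rewrite mulf_neq0 ?invr_eq0.
have trans_x : ~ algebraic (others m) (x m).
  by move/acl_algebraic; apply/negP/x_others.
have Fh : h \in F by rewrite rpred_div ?rpredM ?rpredB ?(F_orbit 0).
have Ma : a \in others m := others_orbit m 0.
have [per|aper] := pselect (exists n, (0 < n)%N && (iter n sigma a == a)).
  have [n /andP[n0 /eqP na] min_n] := ex_minnP per.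
  apply: (difference_eq_finite_orbit (@sigma_others m) (sigma_x m) trans_x Ma MA MB
    sigma_a A0 n0 (iter_fixed_F na Fh) _ eq_h).
  move=> i /andP[i0 lt_in]; apply: contraL lt_in => ia.
  by rewrite -leqNgt min_n // i0.
apply: (difference_eq_infinite_orbit (@sigma_others m) (sigma_x m) trans_x Ma MA MB
  sigma_a A0 sigma_bij _ _ eq_h).
  (* Every generator of [F] other than [x m] lies in [others m], so [h] is a rational function of
     [x m]. *)
  move: Fh; apply: gen_field_poly_values => y [[i ->]|sy]; first by left; apply: others_orbit.
  have lt_y : (index y s < 4)%N by rewrite -size_s index_mem.
  rewrite -(nth_index 0 sy); have [->|ne_y] := eqVneq (index y s) (letter_index m).
    by right.
  by left; apply: sub_acl; right; exists (index y s).
by move=> i i0; apply: contra_notN aper => ia; exists i; rewrite i0.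
Qed.

End Coefficients.

Theorem theorem5p1 (K : fieldType) (sigma : {rmorphism K -> K})
    (sigma_bij : bijective sigma) (sigma_neq_id : ~ sigma =1 id)
    (trdeg_k : infinite_trdeg (prime_field K) (fixed_field sigma))
    (D : divisionRingType) (f : {rmorphism skew_poly sigma -> D})
    (quotD : quotient_division_ring f) :
  exists H : {pred nonzero D}, [/\ group_closed H, is_free H & ~ is_cyclic H].
Proof.
have [a sigma_a] : exists a, sigma a != a.
  apply: contrapT => no_a; apply: sigma_neq_id => a.
  by apply/eqP/contraT => ne_a; case: no_a; exists a.
(* One fixed element for each of the four letters: two generators and their inverses. *)
have [s [size_s s_fixed s_indep]] := fixed_independent a trdeg_k 4%N.
apply: (@linear_factors_free_subgroup _ sigma (coefficient_field sigma a s) _ _ f quotD.1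
  (letter_coefficient sigma a s)).
- exact: coefficient_field_stable.
- exact: letter_coefficient_in.
- exact: letter_coefficient_unsolvable.
Qed.
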